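(* The EKG sequence $\{a(n) : n \ge 1\}$ is a permutation of the natural numbers $\mathbb{N}=\{1,2,3,\dots\}$; that is, every positive integer occurs exactly once among the terms $a(1),a(2),a(3),\dots$.
   Context: The EKG sequence $(a(n))_{n\ge 1}$ is the sequence of positive integers defined by $a(1)=1$, $a(2)=2$ and, for $n\ge 3$, $a(n)$ is the smallest positive integer not in $\{a(k): 1\le k\le n-1\}$ such that $\gcd(a(n-1),a(n))\ge 2$. *)

(* Defs.v *)
From mathcomp Require Import all_boot.

Set Implicit Arguments.
Unset Strict Implicit.
Unset Printing Implicit Defensive.

(* Sequences are functions nat -> nat whose terms are a 1, a 2, a 3, and so on;
   the value a 0 is not a term and is never constrained. *)

Definition ekg_candidate (a : nat -> nat) (n m : nat) : Prop :=
  [/\ 0 < m, (forall k, 1 <= k <= n - 1 -> a k <> m) & 2 <= gcdn (a (n - 1)) m].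

Definition is_EKG (a : nat -> nat) : Prop :=
  [/\ a 1 = 1, a 2 = 2 &
      forall n, 3 <= n ->
        ekg_candidate a n (a n) /\ forall m, ekg_candidate a n m -> a n <= m].

(* The conditions of is_EKG are satisfiable and determine every term a n with
   n >= 1 (lemmas is_EKG_exists and is_EKG_unique), so a sequence satisfying
   is_EKG is the EKG sequence. *)

(* For s nonempty with positive head x, the number x * (sumn s).+1 exceeds every
   element of s, so it is a candidate if 1 < x and the search below succeeds. *)
Definition ekg_next (s : seq nat) : nat :=
  find (fun m => [&& 0 < m, m \notin s & 1 < gcdn (head 0 s) m])
       (iota 0 (head 0 s * (sumn s).+1).+1).

(* The list [:: a (n + 2); ...; a 2; a 1]. *)
Fixpoint ekg_hist (n : nat) : seq nat :=
  if n is n'.+1 then ekg_next (ekg_hist n') :: ekg_hist n' else [:: 2; 1].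

Lemma mem_leq_sumn (s : seq nat) (m : nat) : m \in s -> m <= sumn s.
Proof.
elim: s => //= x s IHs; rewrite inE => /orP [/eqP -> | /IHs le_ms].
  exact: leq_addr.
exact: leq_trans le_ms (leq_addl _ _).
Qed.

Lemma ekg_nextP (s : seq nat) : 1 < head 0 s ->
  let P m := [&& 0 < m, m \notin s & 1 < gcdn (head 0 s) m] in
  P (ekg_next s) /\ forall m, P m -> ekg_next s <= m.
Proof.
move=> x_gt1 P; set x := head 0 s in x_gt1 P *.
have x_gt0 : 0 < x by exact: ltnW.
set B := x * (sumn s).+1.
have PB : P B.
  apply/and3P; split; first by rewrite muln_gt0 x_gt0.
    apply/negP => /mem_leq_sumn; apply/negP; rewrite -ltnNge.
    exact: leq_pmull.
  by rewrite /B gcdnMr.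
have hasP : has P (iota 0 B.+1).
  by apply/hasP; exists B => //; rewrite mem_iota ltnSn.
have lt_next : ekg_next s < B.+1 by move: hasP; rewrite has_find size_iota.
split.
  by have := nth_find 0 hasP; rewrite -/(ekg_next s) nth_iota.
move=> m Pm; rewrite leqNgt; apply/negP => lt_m.
have := before_find 0 lt_m.
by rewrite nth_iota ?(ltn_trans lt_m) // add0n -/(P m) Pm.
Qed.

Lemma ekg_hist_head (n : nat) : 1 < head 0 (ekg_hist n).
Proof.
elim: n => //= n /ekg_nextP [/and3P [m_gt0 _ gt1] _].
exact: leq_trans gt1 (dvdn_leq m_gt0 (dvdn_gcdr _ _)).
Qed.

Lemma is_EKG_exists : exists a, is_EKG a.
Proof.
pose a n := if n is n'.+2 then head 0 (ekg_hist n') else n.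
exists a.
have histP n m : (m \in ekg_hist n) <-> exists2 k, 1 <= k <= n.+2 & a k = m.
  split.
    elim: n => [|n IHn] /=.
      by rewrite !inE => /orP [] /eqP ->; [exists 2 | exists 1].
    rewrite inE => /orP [/eqP -> | /IHn [k /andP [k1 k2] akm]].
      by exists n.+3; rewrite ?leqnn.
    by exists k; rewrite // k1 leqW.
  case=> k /andP [k1 k2] <-; elim: n k2 => [|n IHn].
    by case: k k1 => [|[|[|]]].
  rewrite leq_eqVlt => /orP [/eqP -> | /IHn kin].
    by rewrite /= inE eqxx.
  by rewrite /= inE kin orbT.
split=> // -[|[|[|n]]] // _.
have candE m : ekg_candidate a n.+3 m <->
    [&& 0 < m, m \notin ekg_hist n & 1 < gcdn (head 0 (ekg_hist n)) m].
  rewrite /ekg_candidate subn1 /=; split.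
    case=> -> nocc ->; rewrite andbT /=; apply/negP => /histP [k kn].
    exact: nocc.
  case/and3P=> m0 nin g; split=> // k kn akm.
  by case/negP: nin; apply/histP; exists k.
have [Pn minn] := ekg_nextP (ekg_hist_head n).
split; first exact/candE.
by move=> m /candE /minn.
Qed.

Lemma is_EKG_unique (a b : nat -> nat) :
  is_EKG a -> is_EKG b -> forall n, 1 <= n -> a n = b n.
Proof.
move=> [a1 a2 aP] [b1 b2 bP]; elim/ltn_ind=> -[|[|[|n]]] IH // _.
- by rewrite a1 b1.
- by rewrite a2 b2.
have eq_ab k : 1 <= k <= n.+3 - 1 -> a k = b k.
  by rewrite subn1 => /andP [k1 k2]; apply: IH.
have candE m : ekg_candidate a n.+3 m <-> ekg_candidate b n.+3 m.
  have e : a (n.+3 - 1) = b (n.+3 - 1) by apply: eq_ab; rewrite subn1 leqnn.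
  by split=> -[m0 nocc g]; split=> //;
     [move=> k kn; rewrite -eq_ab //; exact: nocc | rewrite -e
     | move=> k kn; rewrite eq_ab //; exact: nocc | rewrite e].
have [ca la] := aP n.+3 isT; have [cb lb] := bP n.+3 isT.
by apply/eqP; rewrite eqn_leq la ?lb //; apply/candE.
Qed.

(* Main.v *)
Require Import Defs.
From mathcomp Require Import all_boot.
From Stdlib Require Import Classical.
From mathcomp Require Import zify.

Set Implicit Arguments.
Unset Strict Implicit.
Unset Printing Implicit Defensive.

(** Terms are distinct, so they tend to infinity; hence if infinitely many terms
    share a factor with m, then m occurs, since otherwise m would bound
    infinitely many terms.  If a prime p divides infinitely many terms, it
    follows first that every multiple of p occurs, then that infinitely many
    multiples of m occur for each m > 1, and finally that m occurs.

    Such a prime exists.  Otherwise only finitely many terms are even, and for n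
    large every prime factor of a(n) is so large that its double never occurs.
    Let q be the least prime factor of a(n).  Then a(n+1) <= 2q and a(n+1) shares
    a prime r >= q with a(n), so a(n+1), being odd, equals r; but then
    a(n+2) = 2r, a contradiction. *)

Definition infinitely_often (P : nat -> Prop) : Prop :=
  forall N, exists2 n, N <= n & P n.

Lemma not_infinitely_often (P : nat -> Prop) :
  ~ infinitely_often P -> exists N, forall n, N <= n -> ~ P n.
Proof.
by move/not_all_ex_not=> [N nN]; exists N => n le_Nn Pn; apply: nN; exists n.
Qed.

Lemma eventually_forall_leq (P : nat -> nat -> Prop) (M : nat) :
    (forall m, m <= M -> exists N, forall n, N <= n -> P m n) ->
  exists N, forall n, N <= n -> forall m, m <= M -> P m n.
Proof.
elim: M => [|M IHM] evP.
  have [N PN] := evP 0 (leqnn 0).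
  by exists N => n /PN P0n m; rewrite leqn0 => /eqP ->.
have [|N1 PN1] := IHM; first by move=> m /leqW /evP.
have [N2 PN2] := evP M.+1 (leqnn _).
exists (maxn N1 N2) => n; rewrite geq_max => /andP [/PN1 P1 /PN2 P2] m.
by rewrite leq_eqVlt => /orP [/eqP -> | /P1].
Qed.

Lemma initial_terms_bounded (a : nat -> nat) (N : nat) :
  exists M, forall n, n < N -> a n <= M.
Proof.
exists (\max_(i < N) a i) => n lt_nN.
exact: (leq_bigmax (Ordinal lt_nN)).
Qed.

Lemma prime_dvdn_gcd_gt1 (p m n : nat) :
  prime p -> 0 < n -> p %| m -> p %| n -> 1 < gcdn m n.
Proof.
move=> p_pr n_gt0 p_m p_n; apply: leq_trans (prime_gt1 p_pr) _.
by rewrite dvdn_leq ?gcdn_gt0 ?n_gt0 ?orbT // dvdn_gcd p_m.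
Qed.

Section EKG.

Variables (a : nat -> nat) (ha : is_EKG a).

Lemma EKG_gt0 (n : nat) : 1 <= n -> 0 < a n.
Proof.
case: ha => a1 a2 aP; case: n => [|[|[|n]]] // _; rewrite ?a1 ?a2 //.
by have [[]] := aP n.+3 isT.
Qed.

Lemma EKG_neq (i j : nat) : 1 <= i < j -> a i <> a j.
Proof.
case: ha => a1 a2 aP; case: j => [|[|[|j]]] /andP [i1 lt_ij]; try lia.
  by have -> : i = 1; [lia | rewrite a1 a2].
have [[_ a_new _] _] := aP j.+3 isT.
by apply: a_new; rewrite subn1 i1.
Qed.

Lemma EKG_inj (i j : nat) : 1 <= i -> 1 <= j -> a i = a j -> i = j.
Proof.
move=> i1 j1 aij; have [lt_ij|lt_ji|//] := ltngtP i j.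
  by case: (@EKG_neq i j); rewrite ?i1.
by case: (@EKG_neq j i); rewrite ?j1.
Qed.

Lemma EKG_gcd_gt1 (n : nat) : 2 <= n -> 1 < gcdn (a n) (a n.+1).
Proof. by case: ha => _ _ aP n2; have [[_ _ +] _] := aP n.+1 n2; rewrite subn1. Qed.

Lemma EKG_least (n m : nat) : 2 <= n -> 0 < m ->
  (forall k, 1 <= k <= n -> a k <> m) -> 1 < gcdn (a n) m -> a n.+1 <= m.
Proof.
case: ha => _ _ aP n2 m_gt0 m_new gt1; have [_] := aP n.+1 n2; apply.
by split; rewrite ?subn1.
Qed.

Lemma EKG_gt1 (n : nat) : 2 <= n -> 1 < a n.
Proof.
move=> n2; apply: leq_trans (EKG_gcd_gt1 n2) _.
by rewrite dvdn_leq ?dvdn_gcdl ?EKG_gt0 // ltnW.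
Qed.

(** Each of the finitely many values up to [M] is taken at most once, hence is avoided from some
    index on. *)
Lemma EKG_eventually_gt (M : nat) : exists N, forall n, N <= n -> M < a n.
Proof.
have [m _|N aN] := @eventually_forall_leq (fun m n => a n <> m) M.
  have [[k k1 <-]|no_k] := classic (exists2 k, 1 <= k & a k = m).
    by exists k.+1 => n lt_kn /esym; apply: EKG_neq; rewrite k1.
  by exists 1 => n n1 anm; apply: no_k; exists n.
exists N => n le_Nn; rewrite ltnNge; apply/negP => /(aN n le_Nn).
exact.
Qed.

(** A value that never occurs stays available, so each [n >= 2] with [1 < gcdn (a n) m] forces
    [a n.+1 <= m]. *)
Lemma EKG_occurs (m : nat) : 0 < m ->
  infinitely_often (fun n => 1 < gcdn (a n) m) -> exists2 n, 1 <= n & a n = m.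
Proof.
move=> m_gt0 inf_m; apply: NNPP => no_m.
have [N a_gt] := EKG_eventually_gt m.
have [n le_n gt1] := inf_m (maxn N 2).
have := a_gt n.+1; rewrite ltnNge EKG_least //; try lia.
by move=> k /andP [k1 _] akm; apply: no_m; exists k.
Qed.

Lemma EKG_surj_of_prime (p : nat) : prime p ->
    infinitely_often (fun n => p %| a n) ->
  forall m, 1 <= m -> exists2 n, 1 <= n & a n = m.
Proof.
move=> p_pr inf_p.
have mul_p k : 0 < k -> exists2 n, 1 <= n & a n = p * k.
  move=> k_gt0; apply: EKG_occurs => [|N]; first by rewrite muln_gt0 prime_gt0.
  have [n le_Nn p_an] := inf_p N; exists n => //.
  apply: (prime_dvdn_gcd_gt1 p_pr) => //; last exact: dvdn_mulr.
  by rewrite muln_gt0 prime_gt0.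
(* The value 1 shares no factor with anything, so [EKG_occurs] cannot reach it; it is [a 1]. *)
case=> [|[|m]] // _; first by exists 1 => //; case: ha.
apply: EKG_occurs => // N; have [M aM] := initial_terms_bounded a N.
(* The factor [M.+1] makes this multiple of [m.+2] exceed all terms of index below [N], so it occurs
   at [N] or later. *)
have [//|n n1 an] := mul_p (m.+2 * M.+1).
exists n; last by rewrite an mulnCA gcdnC gcdnMr.
rewrite leqNgt; apply/negP => /aM; rewrite an.
have := prime_gt1 p_pr; nia.
Qed.

Lemma EKG_infinitely_often_prime :
  exists2 p, prime p & infinitely_often (fun n => p %| a n).
Proof.
apply: NNPP => no_p.
have fin_p p : prime p -> exists N, forall n, N <= n -> ~ p %| a n.
  by move=> p_pr; apply: not_infinitely_often => inf_p; apply: no_p; exists p.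
have [N2 odd_a] := fin_p 2 isT.
have [M aM] := initial_terms_bounded a N2.
(* Terms before [N2] are at most [M], and later ones are odd. *)
have new_double q k : M < q -> a k <> 2 * q.
  move=> lt_Mq ak; have [/aM|/odd_a] := ltnP k N2; first by rewrite ak; lia.
  by rewrite ak dvdn_mulr.
have [p _|N large_p] := @eventually_forall_leq (fun p n => prime p -> ~ p %| a n) M.
  have [/fin_p [N pN]|] := boolP (prime p); last by exists 0.
  by exists N => n /pN.
pose n := maxn N (maxn N2 2).
have [le_Nn le_N2n n2] : [/\ N <= n, N2 <= n & 2 <= n] by rewrite /n; split; lia.
have an_gt1 := EKG_gt1 n2.
have large r : prime r -> r %| a n -> M < r.
  by move=> r_pr r_an; rewrite ltnNge; apply/negP => /(large_p n le_Nn) /(_ r_pr).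
have step k r : n <= k -> prime r -> r %| a k -> M < r -> a k.+1 <= 2 * r.
  move=> le_nk r_pr r_ak lt_Mr; apply: EKG_least; first exact: leq_trans le_nk.
  - by rewrite muln_gt0 /= prime_gt0.
  - by move=> i _; apply: new_double.
  apply: (prime_dvdn_gcd_gt1 r_pr) => //; last exact: dvdn_mull.
  by rewrite muln_gt0 /= prime_gt0.
(* Among the multiples of [r] up to [2 * r], positivity excludes 0 and oddness excludes [2 * r]. *)
have eq_prime k r : N2 <= k -> 1 <= k -> r %| a k -> a k <= 2 * r -> a k = r.
  move=> le_N2k k1 /dvdnP [[|[|[|c]]] ak] le_ak.
  - by have := EKG_gt0 k1; rewrite ak.
  - by rewrite ak mul1n.
  - by case: (odd_a k le_N2k); rewrite ak dvdn_mulr.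
  by have := EKG_gt0 k1; rewrite ak in le_ak *; nia.
pose r := pdiv (gcdn (a n) (a n.+1)).
have r_pr : prime r by apply/pdiv_prime/EKG_gcd_gt1.
have /andP [r_an r_an1] : (r %| a n) && (r %| a n.+1) by rewrite -dvdn_gcd pdiv_dvd.
have le_an1 : a n.+1 <= 2 * r.
  apply: leq_trans (_ : 2 * pdiv (a n) <= _).
    by apply: step; rewrite ?pdiv_prime ?pdiv_dvd ?large ?pdiv_prime ?pdiv_dvd.
  by rewrite leq_mul2l pdiv_min_dvd ?prime_gt1.
have an1 : a n.+1 = r by apply: eq_prime => //; lia.
(* Since [a n.+1] is the prime [r], the next term is again a multiple of [r]; the same bound and
   parity force it to repeat [r], against distinctness. *)
have r_an2 : r %| a n.+2.
  have g_gt1 : 1 < gcdn r (a n.+2) by rewrite -an1; apply: EKG_gcd_gt1; lia.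
  have /primeP [_ /(_ _ (dvdn_gcdl r (a n.+2)))] := r_pr.
  case/orP=> /eqP g_eq; first by rewrite g_eq in g_gt1.
  by rewrite -g_eq dvdn_gcdr.
have le_an2 : a n.+2 <= 2 * r by apply: step => //; exact: large.
have an2 : a n.+2 = r by apply: eq_prime => //; lia.
by case: (@EKG_neq n.+1 n.+2); rewrite ?an1 ?an2 //; lia.
Qed.

End EKG.

Theorem theorem1 (a : nat -> nat) (ha : is_EKG a) :
  (forall n : nat, 1 <= n -> 1 <= a n) /\
  (forall m : nat, 1 <= m -> exists! n : nat, 1 <= n /\ a n = m).
Proof.
split=> [n|m m1]; first exact: EKG_gt0.
have [p p_pr inf_p] := @EKG_infinitely_often_prime a ha.
have [n n1 an] := @EKG_surj_of_prime a ha p p_pr inf_p m m1.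
exists n; split=> // k [k1 ak]; apply: (@EKG_inj a ha) => //.
by rewrite an ak.
Qed.
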